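(* Let $F$ be a quadratic APN function on $\mathbb{F}_{2^n}$ and $L$ an $\mathbb{F}_2$-linear mapping on $\mathbb{F}_{2^n}$. Let $e_0\in\mathbb{F}_{2^n}$ with $\mathrm{Tr}(e_0)=1$, and let $T_0=\{x\in\mathbb{F}_{2^n}:\mathrm{Tr}(x)=0\}$. Then the mapping $G(x)=F(x)+\mathrm{Tr}(x)L(x)$, $x\in\mathbb{F}_{2^n}$, is a quadratic APN function on $\mathbb{F}_{2^n}$ if and only if, for every $a\in T_0$, the mapping $L_a\colon T_0\to\mathbb{F}_{2^n}$, $L_a(x)=L(x)+B_F(x,a+e_0)$, is one-to-one (equivalently, for every $a\in T_0$, $L_a(x)=0$ with $x\in T_0$ implies $x=0$).
   Context: $\mathrm{Tr}$ denotes the absolute trace $\mathbb{F}_{2^n}\to\mathbb{F}_2$. For $F\colon\mathbb{F}_{2^n}\to\mathbb{F}_{2^n}$, $B_F(x,t):=F(x+t)+F(x)+F(t)+F(0)$; $F$ is quadratic if $B_F$ is $\mathbb{F}_2$-bilinear. $F$ is APN if for all nonzero $a$ and all $b$ the equation $F(x+a)+F(x)=b$ has at most $2$ solutions in $\mathbb{F}_{2^n}$. *)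

(* Defs.v *)
From HB Require Import structures.
From mathcomp Require Import all_boot all_order all_algebra all_fingroup.
From mathcomp Require Import all_solvable all_field.

Set Implicit Arguments.
Unset Strict Implicit.
Unset Printing Implicit Defensive.

Import GRing.Theory.
Local Open Scope ring_scope.

(* The field with 2 ^ n elements is [finvect_type K], where K is an extension *)
(* of 'F_2 with \dim {:K} = n: this alias of K is canonically both a finite   *)
(* field and a splitting field over 'F_2.                                     *)

(* The trace is kept inside the field, 'F_2 being identified with the prime   *)
(* subfield {0, 1} = 1%VS; see absTr_F2.                                      *)
Definition absTr (K : fieldExtType 'F_2) (x : finvect_type K) :
    finvect_type K :=
  galTrace 1%VS {:finvect_type K} x.

Lemma absTr_F2 (K : fieldExtType 'F_2) (x : finvect_type K) :
  absTr x = 0 \/ absTr x = 1.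
Proof.
have galK : galois 1%AS {:finvect_type K}%AS by apply: finField_galois (subvf _).
rewrite /absTr; have /vlineP[c ->] := mem_galTrace galK (memvf x).
case: c => [[|[|//]] lt2].
- left; rewrite (_ : Ordinal lt2 = 0) ?scale0r //; exact: val_inj.
- right; rewrite (_ : Ordinal lt2 = 1) ?scale1r //; exact: val_inj.
Qed.

Definition polarB (K : fieldExtType 'F_2)
    (F : finvect_type K -> finvect_type K) (x t : finvect_type K) :
    finvect_type K :=
  F (x + t) + F x + F t + F 0.

Definition quadratic (K : fieldExtType 'F_2)
    (F : finvect_type K -> finvect_type K) : Prop :=
  bilinear_for *:%R *:%R (polarB F).

Definition APN (K : fieldExtType 'F_2)
    (F : finvect_type K -> finvect_type K) : Prop :=
  forall a b : finvect_type K, a != 0 ->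
    (#|[set x : finvect_type K | (F (x + a) + F x == b)%R]| <= 2)%N.

Definition T0 (K : fieldExtType 'F_2) : {set finvect_type K} :=
  [set x : finvect_type K | absTr x == 0].

Definition Lmap (K : fieldExtType 'F_2)
    (F L : finvect_type K -> finvect_type K) (e0 a x : finvect_type K) :
    finvect_type K :=
  L x + polarB F x (a + e0).

(* Main.v *)
Require Import Defs.
From HB Require Import structures.
From mathcomp Require Import all_boot all_order all_algebra all_fingroup.
From mathcomp Require Import all_solvable all_field.
From mathcomp Require Import ring.

Set Implicit Arguments.
Unset Strict Implicit.
Unset Printing Implicit Defensive.

Import GRing.Theory.
Local Open Scope ring_scope.

(* G is always quadratic, with B_G(x, t) = B_F(x, t) + Tr(x)L(t) + Tr(t)L(x),  *)
(* and a quadratic map is APN iff B(x, t) = 0 forces x = 0 or x = t whenever  *)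
(* t != 0. For x, t of trace 0 this is the APN property of F. If exactly one  *)
(* of them has trace 1, symmetry lets it be t = a + e0 with a in T0, and then *)
(* B_G(x, t) = L_a(x). If both have trace 1, replace x by x + t, which has    *)
(* trace 0, using B_G(t, t) = 0.                                              *)

(** The pairs of a trace-0 [x] and a trace-1 [t] are exactly the pairs [(x, a + e0)] with [x] and
    [a] in [T0]. So the kernel conditions on the maps [L_a] are precisely the part of the APN
    condition for [G] not inherited from [F]. [quadratic_APN] reduces APN to kernels of the polar
    form. *)

Section QuadraticAPN.

Variable K : fieldExtType 'F_2.
Implicit Types (F : finvect_type K -> finvect_type K).
Implicit Types (a t x y z : finvect_type K).

Lemma addKK x : x + x = 0.
Proof. by rewrite addrr_pchar2 // (pchar_lalg (finvect_type K)) pchar_Fp. Qed.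

Lemma addKK_eq0 x y : (x + y == 0) = (x == y).
Proof. by rewrite -(inj_eq (addIr y)) -addrA addKK addr0 add0r. Qed.

(** The only scalars are 0 and 1. *)
Lemma additive_linear_F2 (f : finvect_type K -> finvect_type K) :
  {morph f : x y / x + y} -> linear_for *:%R f.
Proof.
move=> fD [[|[|//]] lt2] u v.
  by rewrite (_ : Ordinal lt2 = 0) ?scale0r ?add0r //; apply: val_inj.
by rewrite (_ : Ordinal lt2 = 1) ?scale1r //; apply: val_inj.
Qed.

Lemma polarBC F x y : polarB F x y = polarB F y x.
Proof. by rewrite /polarB (addrC x y) (addrAC _ (F x)). Qed.

(** This is the APN equation whose right-hand side is its value at 0, so 0 and [t] are always
    solutions. *)
Lemma polarB_eq0 F x t : (polarB F x t == 0) = (F (x + t) + F x == F t + F 0).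
Proof. by rewrite /polarB -addrA addKK_eq0. Qed.

Lemma polarBxx F x : polarB F x x = 0.
Proof. by apply/eqP; rewrite polarB_eq0 addKK addrC. Qed.

(** Additivity in one variable suffices: [polarB] is symmetric, and scalars in 'F_2 come for
    free. *)
Lemma quadraticP F :
  quadratic F <-> (forall t, {morph polarB F ^~ t : x y / x + y}).
Proof.
split=> [[Bl _] t x y | BD].
  by have := Bl t 1 x y; rewrite scale1r => ->; congr (_ + _); apply: scale1r.
split=> [t|x]; apply: additive_linear_F2; first exact: BD.
by move=> y z; rewrite polarBC BD !(polarBC F x).
Qed.

Lemma polarB0x F t : quadratic F -> polarB F 0 t = 0.
Proof.
by move=> /quadraticP BD; have := BD t 0 0; rewrite addr0 addKK.
Qed.

(* The solutions of F(x + t) + F(x) = b, if any, form a coset of the kernel of *)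
(* B_F(-, t), which always contains 0 and t.                                   *)
Lemma quadratic_APN F : quadratic F ->
  APN F <-> (forall x t, t != 0 -> polarB F x t = 0 -> x = 0 \/ x = t).
Proof.
move=> quadF; have BD := (quadraticP F).1 quadF; split=> [apnF x t t0 Bxt | kerB a b a0].
  have [->|x0] := eqVneq x 0; first by left.
  have [->|xt] := eqVneq x t; first by right.
  (* Otherwise 0, [t] and [x] would be three distinct solutions. *)
  have /subset_leq_card/leq_trans/(_ (apnF t (F t + F 0) t0)) :
    [set 0; t; x] \subset [set y | F (y + t) + F y == F t + F 0].
    apply/subsetP=> y; rewrite !inE -polarB_eq0 => /orP[/orP[]|] /eqP->.
    - by rewrite polarB0x.
    - by rewrite polarBxx.
    - by rewrite Bxt.
  by rewrite setUC cardsU1 cards2 !inE negb_or x0 xt eq_sym t0.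
case: (set_0Vmem [set x | F (x + a) + F x == b]) => [->|[y]]; first by rewrite cards0.
rewrite inE => /eqP yb.
apply: (@leq_trans #|[set y; y + a]|); last by rewrite cards2; case: (_ != _).
apply/subset_leq_card/subsetP=> x; rewrite !inE => /eqP xb.
have /(kerB _ _ a0)[/eqP|xya] : polarB F (x + y) a = 0.
- by rewrite BD /polarB xb yb addKK.
- by rewrite addKK_eq0 => ->.
- by rewrite -xya addrCA addKK addr0 eqxx orbT.
Qed.

Lemma absTrD : {morph @absTr K : x y / x + y}.
Proof. by move=> x y; rewrite /absTr raddfD. Qed.

End QuadraticAPN.

Theorem theorem2 (n : nat) (K : fieldExtType 'F_2) (dimK : \dim {:K} = n)
    (F : finvect_type K -> finvect_type K)
    (quadF : quadratic F) (apnF : APN F)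
    (L : {linear finvect_type K -> finvect_type K})
    (e0 : finvect_type K) (Tr_e0 : absTr e0 = 1) :
  let G := fun x : finvect_type K => F x + absTr x * L x in
  ((quadratic G /\ APN G) <->
     (forall a, a \in T0 K -> {in T0 K &, injective (Lmap F L e0 a)})) /\
  ((forall a, a \in T0 K -> {in T0 K &, injective (Lmap F L e0 a)}) <->
     (forall a, a \in T0 K ->
        forall x, x \in T0 K -> Lmap F L e0 a x = 0 -> x = 0)).
Proof.
move=> G.
have LmapD a : {morph Lmap F L e0 a : x y / x + y}.
  by move=> x y; rewrite /Lmap raddfD (quadraticP F).1 // addrACA.
have T0D : {in T0 K &, forall x y, x + y \in T0 K}.
  by move=> x y; rewrite !inE absTrD => /eqP-> /eqP->; rewrite addr0.
have inj_ker : (forall a, a \in T0 K -> {in T0 K &, injective (Lmap F L e0 a)}) <->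
    (forall a, a \in T0 K ->
       forall x, x \in T0 K -> Lmap F L e0 a x = 0 -> x = 0).
  have Lmap0 a : Lmap F L e0 a 0 = 0 by rewrite /Lmap raddf0 polarB0x ?addr0.
  have Tr0 : absTr (0 : finvect_type K) = 0 by rewrite /absTr raddf0.
  split=> H a aT x; first by move=> xT Lx; apply: (H a aT) => //; rewrite ?inE ?Tr0 ?Lmap0.
  move=> y xT yT Lxy; apply/eqP; rewrite -addKK_eq0; apply/eqP/(H a aT); first exact: T0D.
  by rewrite LmapD Lxy addKK.
have BG x t : polarB G x t = polarB F x t + (absTr x * L t + absTr t * L x).
  rewrite /polarB /G absTrD !raddfD [absTr 0]raddf0.
  (* [ring] does not know the characteristic, so the doubled terms are displayed first and cancelled
     afterwards by [addKK]. *)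
  transitivity (F (x + t) + F x + F t + F 0 + (absTr x * L t + absTr t * L x)
      + (absTr x * L x + absTr x * L x) + (absTr t * L t + absTr t * L t)).
    by ring.
  by rewrite !addKK !addr0.
have quadG : quadratic G.
  apply/quadraticP=> t x y; rewrite !BG (quadraticP F).1 // absTrD raddfD mulrDl mulrDr.
  by rewrite [in RHS]addrACA; congr (_ + _); rewrite addrACA.
split=> //; apply: iff_trans (iff_sym inj_ker).
have BGT a x : a \in T0 K -> x \in T0 K -> polarB G x (a + e0) = Lmap F L e0 a x.
  rewrite !inE BG absTrD Tr_e0 => /eqP-> /eqP->.
  by rewrite mul0r !add0r mul1r addrC.
split=> [[_ /(quadratic_APN quadG) kerG] a aT x xT Lx | kerL].
  have tr1 : absTr (a + e0) = 1.
    by move: aT; rewrite inE absTrD Tr_e0 => /eqP->; rewrite add0r.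
  (* Trace 1 makes [a + e0] nonzero, and also rules out [x = a + e0], since [x] has trace 0. *)
  have [|||xe] := kerG x (a + e0); rewrite ?BGT //.
    by apply: contraTneq isT => a0; move: tr1; rewrite a0 /absTr raddf0 => /esym/eqP; rewrite oner_eq0.
  by move: xT; rewrite inE xe tr1 oner_eq0.
split=> //; apply/quadratic_APN => // x t t0 Bxt.
have ker1 y z : absTr y = 0 -> absTr z = 1 -> polarB G y z = 0 -> y = 0.
  (* The index is [a = z + e0], for which [a + e0 = z]. *)
  move=> y0 z1 Byz; have zT : z + e0 \in T0 K by rewrite inE absTrD z1 Tr_e0 addKK.
  have yT : y \in T0 K by rewrite inE y0.
  by apply: (kerL _ zT) => //; rewrite -BGT // -addrA addKK addr0.
have [t_0|t_1] := absTr_F2 t; have [x_0|x_1] := absTr_F2 x.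
- move: Bxt; rewrite BG t_0 x_0 !mul0r !addr0.
  exact: (quadratic_APN quadF).1.
(* With the roles swapped, [ker1] gives [t = 0], contradicting [t0]. *)
- by rewrite (ker1 t x) ?eqxx // 1?polarBC in t0.
- by left; apply: ker1 Bxt.
- right; apply/eqP; rewrite -addKK_eq0; apply/eqP/(ker1 _ t) => //.
    by rewrite absTrD x_1 t_1 addKK.
  by rewrite (quadraticP G).1 // Bxt polarBxx addr0.
Qed.
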